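(* Let $G=(V,E)$ be a connected undirected $(D,c)$-uniform graph with $n=|V|$ vertices and $\delta$-mixing time $T(n)$ for $\delta=\frac{1}{(2cn)^2}$; assume $T(n)$ stays bounded as $n\to\infty$ and the minimum degree $D$ grows with $n$. Let $\eta\in(0,1)$ be a constant such that, for the walk length $t$ used, every edge set $S$ of size $k$ satisfies $P_{\geq 2,S}\le \eta P_{\geq 1,S}$ and $P_{\geq k'+1,S}\le \eta P_{\geq k',S}$ for $1<k'<k$ (such $t=O(|E|/k)$ exists). With $t=O(|E|/k)$, for any edge set $S\subseteq E$ with $|S|=k$, if one takes $m=O(T(n)k\log n)$ independent ''good start'' random walks of length $t$, then with probability $1-O(|E|^{-k})$ the number of walks that traverse at least one edge of $S$ is $g=\Theta(k\log n)$; moreover, with probability $1-O(|E|^{-k})$, the total number of edges of $S$ visited by the $m$ walks (summed over walks, counting for each walk the number of distinct edges of $S$ it visits) is at most $r=(1+\epsilon')\frac{g}{1-\eta}$, where $\epsilon'>0$ is an arbitrarily small number.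
   Context: An undirected graph is $(D,c)$-uniform if every vertex has degree between $D$ and $cD$. A standard random walk moves at each step to a uniformly random neighbor; its stationary distribution is $\mu(v)=d_v/(2|E|)$. The $\delta$-mixing time is the smallest $t'$ such that for every starting vertex the distribution $\mu'$ after $t'$ steps satisfies $\|\mu-\mu'\|_\infty\le\delta$. A ''good start'' random walk of length $t$ starts at vertex $v$ with probability $d_v/(2|E|)$ and then performs $t$ steps of the standard random walk. $P_{\geq k',S}$ denotes the probability that a good start random walk of length $t$ traverses at least $k'$ distinct edges of $S$.
   Formalization: The walk length is taken as t = Θ(|E|/k), bounded below as well as above by a constant times |E|/k; with only t = O(|E|/k) the claim g = Θ(k log n) fails, e.g. for t = 1 and k = 1 on complete graphs. *)

(* Defs.v *)
From HB Require Import structures.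
From mathcomp Require Import all_boot all_order all_algebra.
From mathcomp Require Import reals exp.
Set Implicit Arguments. Unset Strict Implicit. Unset Printing Implicit Defensive.
Import Order.TTheory GRing.Theory Num.Theory.
Local Open Scope ring_scope.

Definition simple_graph (T : finType) (e : rel T) : Prop :=
  symmetric e /\ irreflexive e.

Definition connected_graph (T : finType) (e : rel T) : Prop :=
  forall x y : T, connect e x y.

Definition deg (T : finType) (e : rel T) (x : T) : nat := #|[set y | e x y]|.

Definition edges (T : finType) (e : rel T) : {set {set T}} :=
  [set a : {set T} | [exists x : T, exists y : T, e x y && (a == [set x; y])]].

Definition uniform (R : realType) (T : finType) (e : rel T) (D : nat) (c : R) : Prop :=
  forall v : T, (D <= deg e v)%N /\ (deg e v)%:R <= c * D%:R.

Definition stepP (R : realType) (T : finType) (e : rel T) (x y : T) : R :=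
  if e x y then (deg e x)%:R^-1 else 0.

Fixpoint distr (R : realType) (T : finType) (e : rel T) (s : nat) (x : T) : T -> R :=
  match s with
  | 0 => fun y => (x == y)%:R
  | s'.+1 => fun y => \sum_(z : T) distr R e s' x z * stepP R e z y
  end.

Definition stat (R : realType) (T : finType) (e : rel T) (v : T) : R :=
  (deg e v)%:R / (2 * #|edges e|)%:R.

Definition is_mixing (R : realType) (T : finType) (e : rel T) (delta : R) (t' : nat) : Prop :=
  forall x v : T, `|stat R e v - distr R e t' x v| <= delta.

Definition mixing_time (R : realType) (T : finType) (e : rel T) (delta : R) (t' : nat) : Prop :=
  is_mixing e delta t' /\ forall s, (s < t')%N -> ~ is_mixing e delta s.

Definition walk (T : finType) (t : nat) := {ffun 'I_t.+1 -> T}.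

(* probability of a walk under the "good start" random walk of length t *)
Definition walk_weight (R : realType) (T : finType) (e : rel T) (t : nat) (w : walk T t) : R :=
  stat R e (w ord0) * \prod_(i < t) stepP R e (w (inord i)) (w (inord i.+1)).

Definition visited (T : finType) (S : {set {set T}}) (t : nat) (w : walk T t) : {set {set T}} :=
  [set a in S | [exists i : 'I_t, a == [set w (inord i); w (inord i.+1)]]].

Definition nvis (T : finType) (S : {set {set T}}) (t : nat) (w : walk T t) : nat :=
  #|visited S w|.

Definition P_geq (R : realType) (T : finType) (e : rel T) (t : nat) (S : {set {set T}}) (k' : nat) : R :=
  \sum_(w : walk T t | (k' <= nvis S w)%N) walk_weight R e w.

Definition prob_walks (R : realType) (T : finType) (e : rel T) (t m : nat)
    (A : pred {ffun 'I_m -> walk T t}) : R :=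
  \sum_(W : {ffun 'I_m -> walk T t} | A W) \prod_(i < m) walk_weight R e (W i).

Definition num_hit (T : finType) (S : {set {set T}}) (t m : nat) (W : {ffun 'I_m -> walk T t}) : nat :=
  #|[set i : 'I_m | (0 < nvis S (W i))%N]|.

Definition total_vis (T : finType) (S : {set {set T}}) (t m : nat) (W : {ffun 'I_m -> walk T t}) : nat :=
  \sum_(i < m) nvis S (W i).

Arguments stepP {R T} e x y.
Arguments distr {R T} e s x.
Arguments stat {R T} e v.
Arguments is_mixing {R T} e delta t'.
Arguments mixing_time {R T} e delta t'.
Arguments walk_weight {R T} e {t} w.
Arguments P_geq {R T} e t S k'.
Arguments prob_walks {R T} e t m A.

(* Main.v *)
Require Import Defs.
From HB Require Import structures.
From mathcomp Require Import all_boot all_order all_algebra.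
From mathcomp Require Import reals sequences exp.
From mathcomp Require Import ring lra zify.
Set Implicit Arguments. Unset Strict Implicit. Unset Printing Implicit Defensive.
Import Order.TTheory GRing.Theory Num.Theory.
Local Open Scope ring_scope.

(** Let [X] be the number of distinct edges of [S] visited by one walk, and [P]
    the probability that [X > 0].

    [P] is bounded below by a constant.  An edge is traversed [t / |E|] times
    on average.  Two traversals at times further apart than the mixing time
    are almost independent and only boundedly many pairs per step are closer,
    so the second moment method shows that the edge is visited with
    probability at least a constant times [t / |E|].  Hence [E X] is bounded
    below, whereas the hypothesis on [eta] gives [E X <= P / (1 - eta)].

    Both tail estimates then follow from exponential moments over the [m]
    independent walks: for the lower tail of the number of hits use
    [E expR (- 1_(X > 0))], and for the total number of visits
    [E expR (al * (X - b * 1_(X > 0)))] with [b = (1 + eps) / (1 - eta)], which is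
    less than [1] for a small [al] because, given [X > 0], the variable [X] is
    dominated by a geometric variable of mean [1 / (1 - eta)].  The upper bound
    on the number of hits is just that it is at most [m]. *)

(** * Independent samples and the exponential Markov inequality *)

Section ProductMeasure.
Variables (R : realType) (O : finType) (p : O -> R) (m : nat).
Hypothesis p_ge0 : forall w, 0 <= p w.
Hypothesis p_sum1 : \sum_w p w = 1.

Lemma expectation_prod (f : O -> R) :
  \sum_(W : {ffun 'I_m -> O}) \prod_(i < m) (p (W i) * f (W i))
  = (\sum_w p w * f w) ^+ m.
Proof.
rewrite -(bigA_distr_bigA (fun _ w => p w * f w)) /=.
by rewrite prodr_const card_ord.
Qed.

(** Markov's inequality: off [A] the quantity [u * \prod_i f (W i)] is at least one, and by
    independence its mean is a power. *)
Lemma chernoff (A : pred {ffun 'I_m -> O}) (f : O -> R) (u : R) :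
  0 <= u -> (forall w, 0 <= f w) ->
  (forall W, ~~ A W -> 1 <= u * \prod_(i < m) f (W i)) ->
  1 - u * (\sum_w p w * f w) ^+ m
    <= \sum_(W | A W) \prod_(i < m) p (W i).
Proof.
move=> u0 f0 Abad; rewrite lerBlDr.
have sum1 : \sum_(W : {ffun 'I_m -> O}) \prod_(i < m) p (W i) = 1.
  by rewrite -(bigA_distr_bigA (fun _ w => p w)) /= big1.
rewrite -[leLHS]sum1 (bigID A) /= lerD2l -expectation_prod mulr_sumr.
rewrite [leRHS](bigID A) /= ler_wpDl //.
  apply: sumr_ge0 => W _; rewrite mulr_ge0 // prodr_ge0 // => i _.
  by rewrite mulr_ge0.
apply: ler_sum => W AW; rewrite big_split /= mulrCA.
by rewrite ler_peMr ?Abad // prodr_ge0.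
Qed.

End ProductMeasure.

(** * Sums over walks as iterated kernels *)

Lemma sum_ffunS (R : nmodType) (T : finType) (n : nat)
    (F : {ffun 'I_n.+1 -> T} -> R) :
  \sum_w F w = \sum_x \sum_(w : {ffun 'I_n -> T})
    F [ffun i => if unlift ord0 i is Some j then w j else x].
Proof.
rewrite pair_big /=.
rewrite (reindex (fun q : T * {ffun 'I_n -> T} =>
  [ffun i => if unlift ord0 i is Some j then q.2 j else q.1])) //=.
exists (fun w : {ffun 'I_n.+1 -> T} => (w ord0, [ffun j => w (lift ord0 j)])).
  move=> [x w] _ /=; rewrite ffunE unlift_none; congr pair.
  by apply/ffunP => j; rewrite !ffunE liftK.
move=> w _ /=; apply/ffunP => i; rewrite !ffunE /=.
by case: unliftP => [j ->|->] //; rewrite ffunE.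
Qed.

Section TransferOperator.
Variables (R : realType) (T : finType).

(** The kernels [K i], [K i.+1], ... applied in turn to the constant one. Letting the kernel depend
    on time makes it possible to weight chosen steps of a walk. *)
Fixpoint path_sum (K : nat -> T -> T -> R) (i n : nat) (x : T) : R :=
  if n is n'.+1 then \sum_y K i x y * path_sum K i.+1 n' y else 1.

Lemma path_sum_shift K i n x :
  path_sum (fun l => K l.+1) i n x = path_sum K i.+1 n x.
Proof. by elim: n i x => //= n IH i x; apply: eq_bigr => y _; rewrite IH. Qed.

(** Induction on [t]: the first kernel is absorbed into the initial weight of the shorter walk. *)
Lemma sum_walk (s : T -> R) (K : nat -> T -> T -> R) t :
  \sum_(w : walk T t) s (w ord0) * \prod_(i < t) K i (w (inord i)) (w (inord i.+1))
  = \sum_x s x * path_sum K 0 t x.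
Proof.
elim: t s K => [|t IH] s K.
  rewrite sum_ffunS; apply: eq_bigr => x _ /=.
  rewrite (eq_bigr (fun=> s x)) => [|w _]; last by rewrite ffunE unlift_none big_ord0 mulr1.
  by rewrite sumr_const card_ffun card_ord expn0 mulr1.
rewrite sum_ffunS; apply: eq_bigr => x _ /=.
transitivity (s x * \sum_(w : walk T t) K 0%N x (w ord0) *
   \prod_(i < t) K i.+1 (w (inord i)) (w (inord i.+1))).
  rewrite mulr_sumr; apply: eq_bigr => w _.
  rewrite ffunE unlift_none big_ord_recl; congr (_ * (_ * _)).
    have -> : inord (@ord0 t) = ord0 :> 'I_t.+2 by apply/val_inj; rewrite /= inordK.
    have -> : inord 1 = lift ord0 ord0 :> 'I_t.+2 by apply/val_inj; rewrite /= inordK.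
    by rewrite !ffunE unlift_none liftK.
  apply: eq_bigr => i _ /=.
  have lifti l : (l <= t)%N -> inord l.+1 = lift ord0 (inord l) :> 'I_t.+2.
    by move=> lt; apply/val_inj; rewrite /= /bump !inordK.
  by rewrite !lifti ?(ltnW (ltn_ord i)) //= !ffunE !liftK.
rewrite (IH _ (fun l => K l.+1)); congr (_ * _).
by apply: eq_bigr => y _; rewrite path_sum_shift.
Qed.

End TransferOperator.

(** * Simple graphs and the handshake identity *)

Section SimpleGraph.
Variables (T : finType) (e : rel T).
Hypothesis e_simple : simple_graph e.

Lemma edge_mem x y : ([set x; y] \in edges e) = e x y.
Proof.
have [e_sym _] := e_simple.
rewrite inE; apply/existsP/idP => [[x' /existsP[y' /andP[exy /eqP E]]]|exy]; last first.
  by exists x; apply/existsP; exists y; rewrite exy eqxx.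
have [_ e_irr] := e_simple.
have : x' \in [set x; y] by rewrite E set21.
have : y' \in [set x; y] by rewrite E set22.
rewrite !in_set2 => /orP[/eqP ey|/eqP ey] /orP[/eqP ex|/eqP ex]; subst x' y';
  by rewrite ?e_irr // in exy *; rewrite e_sym.
Qed.

Lemma edgeP a : a \in edges e -> exists x y, e x y /\ a = [set x; y].
Proof.
rewrite inE => /existsP[x /existsP[y /andP[exy /eqP ->]]].
by exists x, y.
Qed.

Lemma edge_neq x y : e x y -> x != y.
Proof. by have [_ irr] := e_simple; case: eqVneq => // ->; rewrite irr. Qed.

Lemma edge_orientations a : a \in edges e ->
  (\sum_x \sum_y ([set x; y] == a) = 2)%N.
Proof.
case/edgeP => x [y [exy ->]]; have nxy := edge_neq exy.
rewrite (bigD1 x) //= [X in (_ + X)%N](bigD1 y) 1?eq_sym //=.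
rewrite [X in (_ + (_ + X))%N]big1 => [|z /andP[zx zy]]; last first.
  apply: big1 => z' _; apply/eqP; rewrite eqb0; apply: contraNneq zx => E.
  have : z \in [set x; y] by rewrite -E set21.
  by rewrite in_set2 (negbTE zy) orbF.
rewrite (bigD1 y) //= eqxx big1 => [|z zy]; last first.
  apply/eqP; rewrite eqb0; apply: contraNneq zy => E.
  have : y \in [set x; z] by rewrite E set22.
  by rewrite in_set2 eq_sym (negbTE nxy) /= eq_sym.
rewrite (bigD1 x) //= setUC eqxx big1 // => z zx.
apply/eqP; rewrite eqb0; apply: contraNneq zx => E.
have : x \in [set y; z] by rewrite E set21.
by rewrite in_set2 (negbTE nxy) /= eq_sym.
Qed.

Lemma deg_sum x : deg e x = (\sum_y e x y)%N.
Proof. by rewrite /deg -sum1dep_card big_mkcond. Qed.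

(** Double counting of oriented edges: each edge has two orientations, and [deg e x] of them start
    at [x]. *)
Lemma handshake : (\sum_x deg e x = 2 * #|edges e|)%N.
Proof.
rewrite mulnC -sum_nat_const -(eq_bigr _ edge_orientations).
under [RHS]eq_bigr do rewrite pair_big.
rewrite exchange_big /= -(pair_big xpredT xpredT (fun x y => \sum_(a in edges e) ([set x; y] == a))%N) /=.
apply: eq_bigr => x _; rewrite deg_sum; apply: eq_bigr => y _.
rewrite -edge_mem; case: (boolP (_ \in _)) => xy.
  rewrite (bigD1 [set x; y]) //= eqxx big1 // => a /andP[_ na].
  by rewrite eq_sym (negbTE na).
rewrite big1 // => a aE; apply/eqP; rewrite eqb0.
by apply: contraNneq xy => ->.
Qed.

Lemma card_edges_le : (#|edges e| <= #|T| ^ 2)%N.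
Proof.
apply: (@leq_trans (2 * #|edges e|)); first by rewrite leq_pmull.
rewrite -handshake -mulnn -sum_nat_const leq_sum // => x _.
exact: max_card.
Qed.

End SimpleGraph.

(** * Stationarity, mixing and expectations along the walk *)

Section RandomWalk.
Variables (R : realType) (T : finType) (e : rel T).
Hypothesis e_simple : simple_graph e.
Hypothesis deg_gt0 : forall x, (0 < deg e x)%N.
Hypothesis edges_gt0 : (0 < #|edges e|)%N.

Let degr_neq0 x : (deg e x)%:R != 0 :> R.
Proof. by rewrite pnatr_eq0 -lt0n. Qed.

Let edgesr_neq0 : #|edges e|%:R != 0 :> R.
Proof. by rewrite pnatr_eq0 -lt0n. Qed.

Lemma stepP_ge0 x y : 0 <= stepP e x y :> R.
Proof. by rewrite /stepP; case: ifP => // _; rewrite invr_ge0. Qed.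

Lemma stat_ge0 x : 0 <= stat e x :> R.
Proof. by rewrite /stat divr_ge0. Qed.

Lemma sum_stat : \sum_x stat e x = 1 :> R.
Proof.
rewrite /stat -mulr_suml -natr_sum handshake // divff //.
by rewrite natrM mulf_neq0 // pnatr_eq0.
Qed.

Lemma sum_stepP x : \sum_y stepP e x y = 1 :> R.
Proof.
rewrite /stepP -big_mkcond /= sumr_const -[RHS](mulVf (degr_neq0 x)).
by rewrite -[LHS]mulr_natr; congr (_ * _%:R); rewrite /deg cardsE.
Qed.

Lemma stat_stepP x y :
  stat e x * stepP e x y = (e x y)%:R / (2 * #|edges e|)%:R :> R.
Proof.
rewrite /stat /stepP; case: (e x y); last by rewrite mulr0 mul0r.
by rewrite mulrAC divff.
Qed.

(** Detailed balance: the flow computed in [stat_stepP] is symmetric in [x] and [y]. *)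
Lemma stat_stationary y : \sum_x stat e x * stepP e x y = stat e y :> R.
Proof.
under eq_bigr do rewrite stat_stepP.
rewrite -mulr_suml -natr_sum /stat deg_sum.
by under eq_bigr => x _ do rewrite (e_simple.1 x y).
Qed.

Lemma distr_ge0 s x y : 0 <= distr e s x y :> R.
Proof.
elim: s y => [|s IH] y /=; first exact: ler0n.
by apply: sumr_ge0 => z _; rewrite mulr_ge0 ?stepP_ge0.
Qed.

Lemma sum_distr s x : \sum_y distr e s x y = 1 :> R.
Proof.
elim: s => [|s IH] /=.
  rewrite (bigD1 x) //= eqxx big1 ?addr0 // => y.
  by rewrite eq_sym => /negbTE ->.
rewrite exchange_big /= -[RHS]IH; apply: eq_bigr => z _.
by rewrite -mulr_sumr sum_stepP mulr1.
Qed.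

(** [distr] is defined by appending a last step; conditioning on the first step is the form that the
    monotonicity of mixing uses. *)
Lemma distrS s x y :
  distr e s.+1 x y = \sum_z stepP e x z * distr e s z y :> R.
Proof.
elim: s y => [|s IH] y.
  rewrite /= (bigD1 x) //= eqxx mul1r big1 ?addr0 => [|z]; last first.
    by rewrite eq_sym => /negbTE ->; rewrite mul0r.
  rewrite (bigD1 y) //= eqxx mulr1 big1 ?addr0 // => z /negbTE ->.
  by rewrite mulr0.
transitivity (\sum_z (\sum_z' stepP e x z' * distr e s z' z) * stepP e z y : R).
  by apply: eq_bigr => z _; rewrite -IH.
under eq_bigr do rewrite mulr_suml.
rewrite exchange_big /=; apply: eq_bigr => z _.
by rewrite mulr_sumr; apply: eq_bigr => z' _; rewrite mulrA.
Qed.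

(** A further step averages the errors over the neighbours of the start, so the largest error cannot
    grow. *)
Lemma is_mixing_leq (delta : R) s s' :
  (s <= s')%N -> is_mixing e delta s -> is_mixing e delta s'.
Proof.
move=> /subnK <-; elim: (s' - s)%N => // r IH /IH {}IH x v.
rewrite addSn distrS -[stat e v]mul1r -(sum_stepP x) mulr_suml -sumrB.
apply: le_trans (ler_norm_sum _ _ _) _.
rewrite -[leRHS]mul1r -(sum_stepP x) mulr_suml ler_sum // => z _.
by rewrite -mulrBr normrM ger0_norm ?stepP_ge0 // ler_wpM2l ?stepP_ge0.
Qed.

Definition expect t (F : walk T t -> R) : R := \sum_w walk_weight e w * F w.

Lemma walk_weight_ge0 t (w : walk T t) : 0 <= walk_weight e w :> R.
Proof. by rewrite mulr_ge0 ?stat_ge0 // prodr_ge0 // => i _; apply: stepP_ge0. Qed.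

Lemma expect_le t (F G : walk T t -> R) :
  (forall w, F w <= G w) -> expect F <= expect G.
Proof. by move=> FG; apply: ler_sum => w _; rewrite ler_wpM2l ?walk_weight_ge0. Qed.

Lemma expect_sum t (I : finType) (P : pred I) (F : I -> walk T t -> R) :
  expect (fun w => \sum_(i | P i) F i w) = \sum_(i | P i) expect (F i).
Proof.
by rewrite /expect exchange_big; apply: eq_bigr => w _; rewrite mulr_sumr.
Qed.

Lemma expectZ t a (F : walk T t -> R) : expect (fun w => a * F w) = a * expect F.
Proof. by rewrite /expect mulr_sumr; apply: eq_bigr => w _; rewrite mulrCA. Qed.

Lemma expectB t (F G : walk T t -> R) :
  expect (fun w => F w - G w) = expect F - expect G.
Proof. by rewrite /expect -sumrB; apply: eq_bigr => w _; rewrite mulrBr. Qed.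

Lemma expect_prod t (phi : nat -> T -> T -> R) :
  expect (fun w : walk T t => \prod_(i < t) phi i (w (inord i)) (w (inord i.+1)))
  = \sum_x stat e x * path_sum (fun i x y => stepP e x y * phi i x y) 0 t x.
Proof.
rewrite -sum_walk; apply: eq_bigr => w _.
by rewrite /walk_weight -mulrA big_split.
Qed.

(** Removes the steps after the last weighted one: the rows of [stepP] sum to one. *)
Lemma path_sum_free (K : nat -> T -> T -> R) l n x :
  (forall i y z, (l <= i)%N -> K i y z = stepP e y z) -> path_sum K l n x = 1.
Proof.
elim: n l x => //= n IH l x KE; rewrite -[RHS](sum_stepP x).
apply: eq_bigr => y _; rewrite KE // IH ?mulr1 // => i z z' li.
by rewrite KE // ltnW.
Qed.

(** Collapses the unweighted steps between two weighted ones into a single [distr]. *)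
Lemma path_sum_distr (K : nat -> T -> T -> R) l s n x :
  (forall i y z, (l <= i < l + s)%N -> K i y z = stepP e y z) ->
  path_sum K l (s + n) x = \sum_y distr e s x y * path_sum K (l + s) n y.
Proof.
elim: s n => [|s IH] n KE.
  rewrite addn0 (bigD1 x) //= eqxx mul1r big1 ?addr0 // => y.
  by rewrite eq_sym => /negbTE ->; rewrite mul0r.
rewrite addSnnS IH => [|i y z /andP[li iu]]; last first.
  by rewrite KE // li addnS ltnS ltnW.
under [RHS]eq_bigr => y _ do rewrite /= mulr_suml.
rewrite exchange_big /=; apply: eq_bigr => z _.
rewrite mulr_sumr; apply: eq_bigr => y _.
by rewrite mulrA addnS KE // leq_addr addnS leqnn.
Qed.

(** Stationarity absorbs the unweighted steps before the first weighted one. *)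
Lemma path_sum_stat (K : nat -> T -> T -> R) s n :
  (forall i y z, (i < s)%N -> K i y z = stepP e y z) ->
  \sum_x stat e x * path_sum K 0 (s + n) x
  = \sum_x stat e x * path_sum K s n x.
Proof.
elim: s n => // s IH n KE.
rewrite addSnnS IH /= => [|i y z si]; last by rewrite KE // ltnW.
under eq_bigr do rewrite mulr_sumr.
rewrite exchange_big /=; apply: eq_bigr => y _.
rewrite -[in RHS]stat_stationary mulr_suml; apply: eq_bigr => x _.
by rewrite KE // mulrA.
Qed.

Lemma walk_weight_sum t : \sum_(w : walk T t) walk_weight e w = 1 :> R.
Proof.
rewrite (sum_walk (stat e) (fun=> stepP e)) -[RHS]sum_stat; apply: eq_bigr => x _.
by rewrite (path_sum_free (K := fun=> stepP e)) ?mulr1.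
Qed.

(** * Traversals of one fixed edge *)

Section OneEdge.
Variable a : {set T}.
Hypothesis aE : a \in edges e.

Definition traverses t (w : walk T t) (i : nat) : R :=
  (a == [set w (inord i); w (inord i.+1)])%:R.

Let ind (x y : T) : R := (a == [set x; y])%:R.
Let hit (x : T) : R := \sum_y stepP e x y * ind x y.

Let ind_ge0 x y : 0 <= ind x y. Proof. exact: ler0n. Qed.

Let hit_ge0 x : 0 <= hit x.
Proof. by apply: sumr_ge0 => y _; rewrite mulr_ge0 ?stepP_ge0. Qed.

Let hit_le1 x : hit x <= 1.
Proof.
rewrite -(sum_stepP x); apply: ler_sum => y _.
by rewrite ler_piMr ?stepP_ge0 // lern1 leq_b1.
Qed.

Let sum_ind : \sum_x \sum_y ind x y = 2.
Proof.
under eq_bigr do rewrite -natr_sum; rewrite -natr_sum -[in RHS](edge_orientations e_simple aE).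
by congr _%:R; apply: eq_bigr => x _; apply: eq_bigr => y _; rewrite eq_sym.
Qed.

Let sum_hit : \sum_x hit x <= 2.
Proof.
rewrite -sum_ind ler_sum // => x _; apply: ler_sum => y _.
rewrite ler_piMl // -[leRHS](sum_stepP x) (bigD1 y) //= lerDl sumr_ge0 // => z _.
exact: stepP_ge0.
Qed.

Let stat_hit : \sum_x stat e x * hit x = #|edges e|%:R^-1.
Proof.
transitivity (\sum_x \sum_y ind x y / (2 * #|edges e|)%:R).
  apply: eq_bigr => x _; rewrite mulr_sumr; apply: eq_bigr => y _.
  rewrite mulrA stat_stepP /ind; case: eqP => [E|_]; last by rewrite mulr0 mul0r.
  by rewrite -edge_mem // -E aE mulr1.
under eq_bigr do rewrite -mulr_suml.
by rewrite -mulr_suml sum_ind natrM invfM mulrA divff ?mul1r // pnatr_eq0.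
Qed.

(** At time [i] the walk is still stationary, and each of the two orientations of [a] carries flow
    [1 / (2 * #|edges e|)]. *)
Lemma expect_traverses t i : (i < t)%N ->
  expect (fun w : walk T t => traverses w i) = #|edges e|%:R^-1.
Proof.
move=> it.
pose phi l x y := if l == i then ind x y else 1.
transitivity (expect (fun w : walk T t =>
    \prod_(l < t) phi l (w (inord l)) (w (inord l.+1)))).
  apply: eq_bigr => w _; congr (_ * _); rewrite (bigD1 (Ordinal it)) //=.
  rewrite /phi eqxx big1 ?mulr1 // => l; rewrite -val_eqE /= => /negbTE -> //.
rewrite expect_prod -(subnKC it) addSnnS path_sum_stat => [|l y z li]; last first.
  by rewrite /phi ltn_eqF // mulr1.
rewrite -stat_hit; apply: eq_bigr => x _; congr (_ * _) => /=.
apply: eq_bigr => y _; rewrite /phi eqxx path_sum_free ?mulr1 // => l z z' il.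
by rewrite gtn_eqF ?mulr1.
Qed.

(** The walk splits into a stationary prefix, the traversal at [i], [j - i.+1] free steps, the
    traversal at [j] and a free suffix; [hit z] is the chance of the second traversal from [z]. *)
Lemma expect_traverses2 t i j (M : R) : (i < j < t)%N ->
  (forall y, \sum_z distr e (j - i.+1) y z * hit z <= M) ->
  expect (fun w : walk T t => traverses w i * traverses w j)
    <= #|edges e|%:R^-1 * M.
Proof.
move=> /andP[ij jt] HM; have it := ltn_trans ij jt.
pose phi l x y := (if l == i then ind x y else 1) * (if l == j then ind x y else 1).
have -> : expect (fun w : walk T t => traverses w i * traverses w j)
  = expect (fun w : walk T t =>
    \prod_(l < t) phi l (w (inord l)) (w (inord l.+1))).
  apply: eq_bigr => w _; congr (_ * _); rewrite big_split /=.
  rewrite (bigD1 (Ordinal it)) //= eqxx big1 ?mulr1; last first.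
    by move=> l; rewrite -val_eqE /= => /negbTE ->.
  rewrite (bigD1 (Ordinal jt)) //= eqxx big1 ?mulr1 //.
  by move=> l; rewrite -val_eqE /= => /negbTE ->.
have -> : t = (i + (j - i.+1 + (t - j.+1).+1).+1)%N by lia.
rewrite expect_prod path_sum_stat => [|l y z li]; last first.
  by rewrite /phi !ltn_eqF ?mulr1 // (ltn_trans li).
rewrite -stat_hit mulr_suml ler_sum // => x _.
rewrite -[leRHS]mulrA ler_wpM2l ?stat_ge0 //= mulr_suml ler_sum // => y _.
rewrite {1}/phi eqxx ltn_eqF // mulr1.
rewrite ler_wpM2l ?mulr_ge0 ?stepP_ge0 //.
rewrite path_sum_distr => [|l z z' li]; last first.
  by rewrite /phi gtn_eqF ?ltn_eqF ?mulr1 //; lia.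
apply: le_trans (HM y); rewrite ler_sum // => z _.
rewrite ler_wpM2l ?distr_ge0 //= ler_sum // => z' _.
rewrite path_sum_free ?mulr1 => [|l v v' jl]; last first.
  by rewrite /phi !gtn_eqF ?mulr1 //; lia.
rewrite ler_wpM2l ?stepP_ge0 // /phi (_ : (_ == i) = false) ?mul1r; last lia.
by rewrite (_ : (_ == j) = true) //; lia.
Qed.

Variables (delta : R) (B : nat).
Hypothesis mixB : is_mixing e delta B.

Let delta_ge0 : 0 <= delta.
Proof.
have [x _] : exists x, x \in T.
  by case/edgeP: aE => // x _; exists x.
exact: le_trans (mixB x x).
Qed.

(** For times at distance at most [B] the second traversal is bounded by one. Otherwise the free gap
    has length at least [B], so [distr] is at most [stat e z + delta], and [sum_hit] turns the error
    into [delta * 2]. *)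
Lemma expect_traverses2_le t i j : (i < t)%N -> (j < t)%N ->
  expect (fun w : walk T t => traverses w i * traverses w j)
    <= #|edges e|%:R^-1 * (((j <= i + B) && (i <= j + B))%N%:R
         + (#|edges e|%:R^-1 + delta * 2)).
Proof.
wlog ij : i j / (i <= j)%N => [hw it jt|it jt].
  have [ij|/ltnW ji] := leqP i j; first exact: hw.
  rewrite andbC; apply: le_trans (hw _ _ ji jt it).
  by apply: expect_le => w; rewrite mulrC.
have tail_ge0 : 0 <= #|edges e|%:R^-1 + delta * 2.
  by rewrite addr_ge0 ?invr_ge0 ?mulr_ge0.
move: ij; rewrite leq_eqVlt => /predU1P[ij|ij].
  rewrite -ij leq_addr /=.
  apply: (@le_trans _ _ (expect (fun w : walk T t => traverses w i))).
    by apply: expect_le => w; rewrite /traverses; case: eqP; rewrite ?mulr1 ?mulr0.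
  by rewrite expect_traverses // ler_peMr ?invr_ge0 // lerDl.
apply: expect_traverses2 => [|y]; first by rewrite ij.
have [jB|jB] := leqP j (i + B).
  rewrite (_ : (i <= j + B)%N) /=; last lia.
  apply: (@le_trans _ _ 1); last by rewrite lerDl.
  rewrite -(sum_distr (j - i.+1) y) ler_sum // => z _.
  by rewrite ler_piMr ?distr_ge0.
rewrite /= add0r -stat_hit.
apply: (@le_trans _ _ (\sum_z (stat e z + delta) * hit z)).
  apply: ler_sum => z _; rewrite ler_wpM2r // -lerBlDl.
  have mixj : is_mixing e delta (j - i.+1) by apply: is_mixing_leq mixB; lia.
  by apply: le_trans (mixj y z); rewrite distrC ler_norm.
under eq_bigr do rewrite mulrDl; rewrite big_split /= lerD2l -mulr_sumr.
by rewrite ler_wpM2l.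
Qed.

End OneEdge.
End RandomWalk.

(** * Probability of visiting an edge and number of visited edges *)

Lemma sum_window (t i B : nat) :
  (\sum_(j < t) ((j <= i + B) && (i <= j + B)) <= 2 * B + 1)%N.
Proof.
rewrite -(big_mkord xpredT (fun j => ((j <= i + B) && (i <= j + B))%N : nat)).
rewrite -big_mkcond /= sum1_count -size_filter -(size_iota (i - B) (2 * B + 1)).
apply: uniq_leq_size => [|j]; first by rewrite filter_uniq ?iota_uniq.
by rewrite mem_filter !mem_iota; lia.
Qed.

Lemma sum_expr_le (R : realType) (eta : R) (n : nat) :
  0 < eta < 1 -> \sum_(j < n) eta ^+ j <= (1 - eta)^-1.
Proof.
move=> /andP[e0 e1]; have e1' : 0 < 1 - eta by rewrite subr_gt0.
rewrite -[leRHS]mul1r ler_pdivlMr // mulrC -opprB mulNr -subrX1 opprB.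
by rewrite gerBl exprn_ge0 // ltW.
Qed.

Section VisitedEdges.
Variables (R : realType) (T : finType) (e : rel T).
Hypothesis e_simple : simple_graph e.
Hypothesis deg_gt0 : forall x, (0 < deg e x)%N.
Hypothesis edges_gt0 : (0 < #|edges e|)%N.
Variables (delta : R) (B t : nat) (kappa : R).
Hypothesis mixB : is_mixing e delta B.
Hypothesis kappa_gt0 : 0 < kappa.
(** For a fixed first time, at most [2 * B + 1] second times are close, and each of the [t] second
    times contributes the almost independent term. *)
Hypothesis kappa_ge :
  (2 * B + 1)%:R + t%:R * (#|edges e|%:R^-1 + delta * 2) <= kappa.

(* Second moment method: [1 >= 2 N / kappa - (N / kappa)^2] when the number
   of traversals [N] is positive, and [E N^2 <= kappa E N]. *)
Lemma expect_visited (a : {set T}) : a \in edges e ->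
  t%:R / #|edges e|%:R / kappa
    <= expect e (fun w : walk T t =>
         [exists i : 'I_t, a == [set w (inord i); w (inord i.+1)]]%:R).
Proof.
move=> aE; pose N (w : walk T t) : R := \sum_(i < t) traverses R a w i.
have EN : expect e N = t%:R / #|edges e|%:R.
  rewrite /N expect_sum (eq_bigr (fun=> #|edges e|%:R^-1)) => [|i _].
    by rewrite sumr_const card_ord -[LHS]mulr_natl.
  exact: expect_traverses.
have EN2 : expect e (fun w => N w ^+ 2) <= kappa * (t%:R / #|edges e|%:R).
  have -> : expect e (fun w => N w ^+ 2) = \sum_(i < t) \sum_(j < t)
      expect e (fun w : walk T t => traverses R a w i * traverses R a w j).
    transitivity (\sum_(i < t) expect e (fun w : walk T t =>
        \sum_(j < t) traverses R a w i * traverses R a w j)).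
      rewrite -expect_sum; apply: eq_bigr => w _; congr (_ * _).
      by rewrite expr2 mulr_suml; apply: eq_bigr => i _; rewrite mulr_sumr.
    by apply: eq_bigr => i _; rewrite -expect_sum.
  rewrite mulrC -mulrA mulr_natl -[in leRHS](card_ord t) -sumr_const.
  apply: ler_sum => i _.
  apply: (@le_trans _ _ (\sum_(j < t) #|edges e|%:R^-1 * (((j <= i + B) && (i <= j + B))%N%:R
         + (#|edges e|%:R^-1 + delta * 2)))).
    by apply: ler_sum => j _; apply: expect_traverses2_le.
  rewrite -mulr_sumr ler_wpM2l ?invr_ge0 // big_split /=.
  apply: le_trans kappa_ge; rewrite sumr_const card_ord -[X in _ + X <= _]mulr_natl lerD2r.
  by rewrite -natr_sum ler_nat sum_window.
apply: (@le_trans _ _ (expect e (fun w => (2 / kappa) * N w - kappa ^- 2 * N w ^+ 2))).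
  rewrite expectB !expectZ EN lerBrDr.
  apply: (@le_trans _ _ (t%:R / #|edges e|%:R / kappa
       + kappa ^- 2 * (kappa * (t%:R / #|edges e|%:R)))).
    by rewrite lerD2l ler_wpM2l // invr_ge0 exprn_ge0 // ltW.
  by rewrite le_eqVlt; apply/predU1l; field; rewrite !gt_eqF // ltr0n.
apply: expect_le => w; case: existsP => [_|noi].
  rewrite -subr_ge0.
  have -> : 1 - (2 / kappa * N w - kappa ^- 2 * N w ^+ 2) = (1 - N w / kappa) ^+ 2.
    by field; rewrite gt_eqF.
  exact: sqr_ge0.
suff -> : N w = 0 by rewrite expr0n /= !mulr0 subr0.
apply: big1 => i _; rewrite /traverses; case: eqP => // ai.
by case: noi; exists i; apply/eqP.
Qed.

Variable S : {set {set T}}.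
Hypothesis SE : S \subset edges e.

Lemma expect_nvis :
  #|S|%:R * (t%:R / #|edges e|%:R / kappa)
    <= expect e (fun w : walk T t => (nvis S w)%:R).
Proof.
rewrite mulr_natl -sumr_const.
apply: le_trans (ler_sum _ (fun a aS => expect_visited (subsetP SE a aS))) _.
rewrite -expect_sum; apply: expect_le => w.
rewrite -natr_sum -big_mkcondr /= sum1dep_card ler_nat /nvis /visited.
by apply/eq_leq/eq_card => a; rewrite !inE.
Qed.

Lemma P_geqE k' :
  P_geq e t S k' = expect e (fun w : walk T t => (k' <= nvis S w)%N%:R) :> R.
Proof.
rewrite /P_geq big_mkcond; apply: eq_bigr => w _.
by case: ifP; rewrite ?mulr1 ?mulr0.
Qed.

Variables (k : nat) (eta : R).
Hypothesis Sk : #|S| = k.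
Hypothesis eta01 : 0 < eta < 1.
Hypothesis P_geq2 : P_geq e t S 2 <= eta * P_geq e t S 1.
Hypothesis P_geqS : forall k', (1 < k' < k)%N ->
  P_geq e t S k'.+1 <= eta * P_geq e t S k'.

(** Chaining the ratio hypotheses: given a hit, the number of visited edges has a geometrically
    decaying tail. *)
Lemma P_geq_geometric j : (j < k)%N ->
  P_geq e t S j.+1 <= eta ^+ j * P_geq e t S 1.
Proof.
case/andP: eta01 => eta0 _.
elim: j => [|[|j] IH] jk; rewrite ?mul1r ?expr1 //.
apply: le_trans (P_geqS _) _; first by rewrite jk.
by rewrite exprS -mulrA; apply: ler_wpM2l; [exact: ltW|exact/IH/ltnW].
Qed.

(* Abel summation: [f X = f 0 + \sum_(j < k) (f j.+1 - f j) * 1_(j < X)]. *)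
Lemma expect_nvis_le (f : nat -> R) :
  (forall j, (0 < j)%N -> f j <= f j.+1) ->
  expect e (fun w : walk T t => f (nvis S w))
    <= f 0%N + P_geq e t S 1 * \sum_(j < k) (f j.+1 - f j) * eta ^+ j.
Proof.
move=> f_incr.
have abel X : (X <= k)%N -> f X = f 0%N + \sum_(j < k) (f j.+1 - f j) * (j < X)%N%:R.
  move=> Xk; under eq_bigr do rewrite mulr_natr mulrb.
  rewrite -big_mkcond -(big_mkord (fun j => j < X)%N (fun j => f j.+1 - f j)).
  by rewrite -(big_nat_widen 0 X k xpredT) // telescope_sumr // addrC subrK.
have -> : expect e (fun w : walk T t => f (nvis S w))
    = f 0%N + \sum_(j < k) (f j.+1 - f j) * P_geq e t S j.+1.
  transitivity (\sum_(w : walk T t) (walk_weight e w * f 0%N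
     + walk_weight e w * \sum_(j < k) (f j.+1 - f j) * (j < nvis S w)%N%:R)).
    apply: eq_bigr => w _; rewrite -mulrDr -abel // -Sk.
    by apply/subset_leq_card/subsetP => a; rewrite inE => /andP[].
  rewrite big_split; congr (_ + _); first by rewrite -mulr_suml walk_weight_sum ?mul1r.
  rewrite -[LHS]/(expect e (fun w : walk T t =>
    \sum_(j < k) (f j.+1 - f j) * (j < nvis S w)%N%:R)) expect_sum.
  by apply: eq_bigr => j _; rewrite expectZ P_geqE.
(* At [j = 0] both sides agree whatever the sign of [f 1 - f 0]. Hence [f] may drop from [0] to [1],
   as the exponential weights used for the tails can do. *)
rewrite lerD2l mulr_sumr ler_sum // => -[[|j] jk] _ /=.
  by rewrite mulr1 mulrC.
rewrite mulrCA ler_wpM2l ?subr_ge0 ?f_incr // mulrC.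
exact: P_geq_geometric.
Qed.

(** Compares two bounds on the mean number of visited edges: [expect_nvis] from below, and
    [expect_nvis_le] for the identity, at most [P_geq e t S 1 / (1 - eta)], from above. *)
Lemma P_geq1_ge : k%:R * (t%:R / #|edges e|%:R) * ((1 - eta) / kappa)
  <= P_geq e t S 1.
Proof.
have eta1 : 0 < 1 - eta by rewrite subr_gt0; case/andP: eta01.
have f_incr j : (0 < j)%N -> j%:R <= j.+1%:R :> R by rewrite ler_nat.
have := le_trans expect_nvis (expect_nvis_le (f := fun j => j%:R) f_incr).
rewrite Sk add0r => H.
have -> : k%:R * (t%:R / #|edges e|%:R) * ((1 - eta) / kappa)
    = k%:R * (t%:R / #|edges e|%:R / kappa) * (1 - eta) by ring.
rewrite -ler_pdivlMr //; apply: le_trans H _.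
rewrite ler_wpM2l //.
  rewrite P_geqE; apply: sumr_ge0 => w _.
  by rewrite mulr_ge0 ?walk_weight_ge0.
apply: le_trans (sum_expr_le k eta01).
by apply: ler_sum => j _; rewrite -natrB // subSnn mul1r.
Qed.

End VisitedEdges.

(** * Exponential moment of a geometric variable *)

Section ExponentialTilt.
Variables (R : realType) (eta eps : R).
Hypothesis eta01 : 0 < eta < 1.
Hypothesis eps_gt0 : 0 < eps.
Let b := (1 + eps) / (1 - eta).

(* [expR al * (1 - eta) / (1 - eta * expR al)] is the moment generating
   function at [al] of a geometric variable of mean [1 / (1 - eta)], so the
   tilt exists because [b] exceeds that mean. *)
Lemma exists_tilt : exists2 al : R, 0 < al &
  expR (al * (1 - b)) * (1 - eta) < 1 - eta * expR al.
Proof.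
case/andP: eta01 => eta0 eta1; have eta1' : 0 < 1 - eta by rewrite subr_gt0.
have ee : 0 < 1 + eta * eps by rewrite addr_gt0 // mulr_gt0.
(* [h] is chosen so that [h * (1 + eta * b) = eps / 2]: in the final expansion the first-order gain
   [h * eps] then exceeds the quadratic loss by [h * (eps / 2)]. *)
pose h := eps * (1 - eta) / (2 * (1 + eta * eps)).
have h0 : 0 < h by rewrite divr_gt0 ?mulr_gt0.
have h1 : 0 < 1 + h by rewrite addr_gt0.
exists (ln (1 + h)); first by rewrite ln_gt0 // ltrDl.
have u_ln : expR (ln (1 + h)) = 1 + h by rewrite lnK // posrE.
set al := ln (1 + h) in u_ln *; rewrite u_ln.
have al_ge : h / (1 + h) <= al.
  have := expR_ge1Dx (- al); rewrite expRN u_ln.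
  have -> : h / (1 + h) = 1 - (1 + h)^-1 by field; rewrite gt_eqF.
  lra.
have b0 : 0 < b by rewrite divr_gt0 // addr_gt0.
rewrite (_ : al * (1 - b) = al - al * b); last by ring.
rewrite expRD u_ln expRN.
have q_ge : 1 + b * (h / (1 + h)) <= expR (al * b).
  apply: le_trans (expR_ge1Dx _); rewrite lerD2l mulrC.
  by rewrite ler_wpM2r // ltW.
have q0 := expR_gt0 (al * b).
rewrite mulrAC ltr_pdivrMr //.
have hE : h * (2 * (1 + eta * eps)) = eps * (1 - eta).
  by rewrite /h mulfVK // gt_eqF // mulr_gt0.
have pos : 0 < 1 - eta * (1 + h) by nra.
apply: lt_le_trans (ler_wpM2l (ltW pos) q_ge).
rewrite -(ltr_pM2r h1).
have -> : (1 - eta * (1 + h)) * (1 + b * (h / (1 + h))) * (1 + h)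
   = (1 - eta * (1 + h)) * (1 + h + b * h) by field; rewrite gt_eqF.
have bE : b * (1 - eta) = 1 + eps by rewrite /b mulfVK // gt_eqF.
have hb : h * (1 + eta * b) = eps / 2.
  have -> : h * (1 + eta * b) = h * (1 + eta * eps) / (1 - eta).
    by rewrite /b; field; rewrite gt_eqF.
  by rewrite /h; field; rewrite !gt_eqF.
rewrite -subr_gt0.
have -> : (1 - eta * (1 + h)) * (1 + h + b * h) - (1 + h) * (1 - eta) * (1 + h)
  = h * (b * (1 - eta) - 1) - h * (h * (1 + eta * b)) by ring.
have -> : h * (b * (1 - eta) - 1) - h * (h * (1 + eta * b)) = h * (eps / 2).
  by rewrite bE hb; field.
by rewrite mulr_gt0 // divr_gt0.
Qed.

(** Multiplied over the walks, this compares the total number of visits with [b] times the number of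
    hits. *)
Definition tilt (al : R) (j : nat) : R := expR (al * (j%:R - b * (0 < j)%N%:R)).

Lemma tiltS al j : tilt al j.+1 = expR (al * (1 - b)) * expR al ^+ j.
Proof.
by rewrite /tilt mulr1 -expRM_natr -expRD; congr expR; rewrite -natr1; ring.
Qed.

Lemma tilt_incr al j : 0 <= al -> (0 < j)%N -> tilt al j <= tilt al j.+1.
Proof.
move=> al0; case: j => // j _; rewrite !tiltS ler_wpM2l ?expR_ge0 //.
by rewrite exprS ler_peMl ?exprn_ge0 ?expR_ge0 // -expR0 ler_expR.
Qed.

(** The right-hand side is the sum of the infinite series, so the bound is uniform in [k]; the
    omitted remainder is explicit and nonnegative. *)
Lemma sum_tilt al k : 0 < al -> eta * expR al < 1 -> (0 < k)%N ->
  \sum_(j < k) (tilt al j.+1 - tilt al j) * eta ^+ j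
    <= expR (al * (1 - b)) * (1 - eta) / (1 - eta * expR al) - 1.
Proof.
case/andP: eta01 => eta0 eta1 al0 v1; have v1' : 1 - eta * expR al != 0.
  by rewrite gt_eqF // subr_gt0.
(* The induction starts from one term, because [tilt al 0 = 1] does not follow the geometric pattern
   of [tiltS]. *)
case: k => // k _; set q := expR (al * _); set u := expR al.
have q0 : 0 <= q by apply: expR_ge0.
have u1 : 0 <= u - 1 by rewrite subr_ge0 -expR0 ler_expR ltW.
suff E : \sum_(j < k.+1) (tilt al j.+1 - tilt al j) * eta ^+ j
    + q * (u - 1) * (eta * u) ^+ k.+1 / (u * (1 - eta * u))
    = q * (1 - eta) / (1 - eta * u) - 1.
  rewrite -E lerDl divr_ge0 ?mulr_ge0 ?exprn_ge0 ?mulr_ge0 ?expR_ge0 ?(ltW eta0) //.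
  by rewrite subr_ge0 ltW.
have u0 : u != 0 by rewrite gt_eqF // expR_gt0.
elim: k => [|k IH].
  rewrite big_ord1 tiltS !expr0 expr1 /tilt mulr0 subr0 mulr0 expR0 -/q.
  by field; rewrite v1' u0.
rewrite big_ord_recr /= -IH -!addrA; congr (_ + _).
rewrite !tiltS -/q -/u !exprS exprMn.
by field; rewrite v1' u0.
Qed.
End ExponentialTilt.

(** * Tail bounds for independent walks *)

Section Tail.
Variables (R : realType) (T : finType) (e : rel T).
Hypothesis e_simple : simple_graph e.
Hypothesis deg_gt0 : forall x, (0 < deg e x)%N.
Hypothesis edges_gt0 : (0 < #|edges e|)%N.

(** The failure probability is at most [expR L * expR (- p) ^+ m], hence at most [expR (L - 3 * L)],
    which is below [#|edges e|%:R ^- k]. *)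
Lemma prob_walks_ge (t m k : nat) (S : {set {set T}}) (f : nat -> R) (p L : R)
    (A : pred {ffun 'I_m -> walk T t}) :
  (forall j, 0 <= f j) ->
  expect e (fun w : walk T t => f (nvis S w)) <= 1 - p ->
  3 * L <= p * m%:R -> #|edges e|%:R ^+ k <= expR (2 * L) ->
  (forall W, ~~ A W -> 1 <= expR L * \prod_(i < m) f (nvis S (W i))) ->
  1 - #|edges e|%:R ^- k <= prob_walks e t m A :> R.
Proof.
move=> f0 fp Lm kL bad.
have := chernoff (walk_weight_ge0 R e (t := t))
  (walk_weight_sum R e_simple deg_gt0 edges_gt0 t) (expR_ge0 L)
  (fun w => f0 (nvis S w)) bad.
apply: le_trans; rewrite lerD2l lerN2.
have E0 : 0 <= expect e (fun w : walk T t => f (nvis S w)).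
  by apply: sumr_ge0 => w _; rewrite mulr_ge0 ?walk_weight_ge0.
have Ep : expect e (fun w : walk T t => f (nvis S w)) <= expR (- p).
  exact: le_trans fp (expR_ge1Dx _).
apply: (@le_trans _ _ (expR L * expR (- p) ^+ m)).
  by rewrite ler_wpM2l ?expR_ge0 // lerXn2r ?nnegrE ?expR_ge0.
rewrite -expRM_natr -expRD.
apply: (@le_trans _ _ (expR (- (2 * L)))); first by rewrite ler_expR; lra.
by rewrite expRN lef_pV2 ?posrE ?expR_gt0 // exprn_gt0 // ltr0n.
Qed.

End Tail.

Lemma num_hitE (R : realType) (T : finType) (S : {set {set T}}) t m
    (W : {ffun 'I_m -> walk T t}) :
  (num_hit S W)%:R = \sum_(i < m) (0 < nvis S (W i))%N%:R :> R.
Proof.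
rewrite -natr_sum; congr _%:R.
by rewrite /num_hit -sum1dep_card big_mkcond.
Qed.

(** At time zero the law is a point mass, and the starts [x] and [y] would force [stat e y] within
    [1 / 4] of both [0] and [1]. Positivity lets the factor [Tmix j] enter the bound on the number
    of walks. *)
Lemma mixing_time_gt0 (R : realType) (T : finType) (e : rel T) (c : R) (s : nat) :
  1 <= c -> (1 < #|T|)%N ->
  is_mixing e ((2 * c * #|T|%:R) ^- 2) s -> (0 < s)%N.
Proof.
move=> c1 /card_gt1P[x [y [_ _ xy]]] mix; rewrite lt0n; apply/eqP => s0.
move: mix; rewrite s0 => mix.
have := mix x y; have := mix y y; rewrite /= eqxx (negbTE xy) subr0.
set d := _ ^- 2 => H1 H2.
have n1 : 1 <= #|T|%:R :> R by rewrite ler1n; apply/card_gt0P; exists x.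
have d4 : d <= 4^-1.
  have : 2 <= 2 * c * #|T|%:R by nra.
  move=> H; rewrite /d lef_pV2 ?posrE ?exprn_gt0 //; last by lra.
  by nra.
have := ler_norm (stat e y : R); move: H1; rewrite distrC.
have := ler_norm (1 - stat e y : R); lra.
Qed.

(** * Choice of the constants and the two tail estimates *)

Theorem theorem6 (R : realType) (V : nat -> finType) (adj : forall j, rel (V j))
    (D : nat -> nat) (c : R) (Tmix : nat -> nat) (k : nat -> nat) (t : nat -> nat)
    (eta tlo thi : R) :
  1 <= c ->
  (forall j, simple_graph (adj j)) ->
  (forall j, connected_graph (adj j)) ->
  (forall j, uniform (adj j) (D j) c) ->
  (forall j, mixing_time (adj j) ((2 * c * #|V j|%:R) ^- 2) (Tmix j)) ->
  (exists B : nat, forall j, (Tmix j <= B)%N) ->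
  (forall M : nat, exists J : nat, forall j, (J <= j)%N -> (M <= D j)%N) ->
  0 < eta < 1 ->
  (forall j, (1 <= k j <= #|edges (adj j)|)%N) ->
  0 < tlo -> 0 < thi ->
  (forall j, tlo * #|edges (adj j)|%:R / (k j)%:R <= (t j)%:R <= thi * #|edges (adj j)|%:R / (k j)%:R) ->
  (forall j (S : {set {set V j}}), S \subset edges (adj j) -> #|S| = k j ->
     P_geq (adj j) (t j) S 2 <= eta * P_geq (adj j) (t j) S 1 /\
     (forall k', (1 < k' < k j)%N -> P_geq (adj j) (t j) S k'.+1 <= eta * P_geq (adj j) (t j) S k')) ->
  forall eps : R, 0 < eps ->
  exists (m : nat -> nat) (A c1 c2 C : R) (J : nat),
    0 < A /\ 0 < c1 /\ 0 < c2 /\ 0 < C /\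
    forall j, (J <= j)%N ->
      (m j)%:R <= A * (Tmix j)%:R * (k j)%:R * ln (#|V j|%:R) /\
      forall S : {set {set V j}}, S \subset edges (adj j) -> #|S| = k j ->
        1 - C * (#|edges (adj j)|%:R ^- k j) <=
          prob_walks (adj j) (t j) (m j)
            (fun W => (c1 * (k j)%:R * ln (#|V j|%:R) <= (num_hit S W)%:R)
                      && ((num_hit S W)%:R <= c2 * (k j)%:R * ln (#|V j|%:R))) /\
        1 - C * (#|edges (adj j)|%:R ^- k j) <=
          prob_walks (adj j) (t j) (m j)
            (fun W => (total_vis S W)%:R <= (1 + eps) * (num_hit S W)%:R / (1 - eta)).
Proof.
move=> c1 simple _ unif mix [B TB] _ eta01 kE tlo0 thi0 tE Pgeom eps eps0.
have [eta0 eta1] := andP eta01.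
have eta1' : 0 < 1 - eta by rewrite subr_gt0.
have [al al0 al_tilt] := exists_tilt eta01 eps0.
set b := (1 + eps) / (1 - eta) in al_tilt.
have v1 : eta * expR al < 1.
  rewrite -subr_gt0; apply: lt_trans al_tilt.
  by rewrite mulr_gt0 ?expR_gt0.
pose rho := expR (al * (1 - b)) * (1 - eta) / (1 - eta * expR al).
have rho1 : 0 < 1 - rho by rewrite subr_gt0 ltr_pdivrMr ?mul1r ?subr_gt0.
have einv : 0 < 1 - expR (-1) :> R by rewrite subr_gt0 -[ltRHS]expR0 ltr_expR; lra.
(* The smaller of the two exponential-moment gaps, so that one number of walks serves both tails. *)
pose tau : R := Num.min (1 - rho) (1 - expR (-1)).
have tau0 : 0 < tau by rewrite lt_min rho1 einv.
(* One [thi] pays for [t / |E|], the other for the mixing error [t * (delta * 2)]. *)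
pose kappa : R := (2 * B + 1)%:R + 2 * thi.
have kappa0 : 0 < kappa by rewrite ltr_wpDl ?mulr_gt0.
pose p0 := tlo * ((1 - eta) / kappa).
have p00 : 0 < p0 by rewrite mulr_gt0 ?divr_gt0.
(* Makes [M * L j] walks satisfy the requirement [3 * L <= p * m] of [prob_walks_ge] with
   [p = p0 * tau]. *)
pose M := 3 / (p0 * tau).
have M0 : 0 < M by apply: divr_gt0; [rewrite ltr0n|exact: mulr_gt0].
have ln2 : 0 < ln 2 :> R by rewrite ln_gt0 // ltr1n.
(* The second summand pays for rounding up: [1 <= L j / ln 2]. *)
pose A := M + (ln 2)^-1.
have A0 : 0 < A by rewrite addr_gt0 ?invr_gt0.
pose L j : R := (k j)%:R * ln (#|V j|%:R).
exists (fun j => (Num.truncn (M * L j)).+1), A, 1, (A * B.+1%:R), 1, 0%N.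
split; first exact: A0.
split; first exact: ltr01.
split; first by rewrite mulr_gt0 ?ltr0n.
split; first exact: ltr01.
move=> j _.
have [k1 kle] := andP (kE j).
have edges0 : (0 < #|edges (adj j)|)%N by apply: leq_trans kle.
have [x [y exy]] : exists x y : V j, adj j x y.
  have /card_gt0P[a /edgeP[x [y [exy _]]]] := edges0.
  by exists x, y.
have V2 : (1 < #|V j|)%N.
  by apply/card_gt1P; exists x, y; split => //; apply: (edge_neq (simple j) exy).
(* If [D j] were zero, the upper degree bound would isolate [x], which has the neighbour [y]. *)
have deg0 v : (0 < deg (adj j) v)%N.
  apply: leq_trans (unif j v).1; rewrite lt0n; apply/eqP => D0.
  have := (unif j x).2; rewrite D0 mulr0 lern0 /deg cards_eq0 => /eqP E.
  by have := in_set0 y; rewrite -E inE exy.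
have kr1 : 1 <= (k j)%:R :> R by rewrite ler1n.
have L2 : ln 2 <= L j.
  apply: (@le_trans _ _ (ln (#|V j|%:R))); first by rewrite ler_ln ?posrE ?ltr0n ?ler_nat // ltnW.
  by rewrite ler_peMl // ln_ge0 // ler1n ltnW.
have L0 : 0 < L j by apply: lt_le_trans L2.
have /andP[mlo mhi] := truncn_itv (ltW (mulr_gt0 M0 L0)).
set m := (Num.truncn (M * L j)).+1 in mhi *.
have mA : m%:R <= A * L j.
  rewrite /m -natr1 mulrDl lerD // -[leLHS](mulVf (lt0r_neq0 ln2)).
  by rewrite ler_wpM2l // invr_ge0 ltW.
have T1 : (0 < Tmix j)%N by apply: mixing_time_gt0 c1 V2 (mix j).1.
split.
  apply: le_trans mA _; rewrite -!mulrA ler_wpM2l ?(ltW A0) //.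
  by rewrite ler_peMl ?(ltW L0) // ler1n.
move=> S SE Sk.
have [P2 PS] := Pgeom j S SE Sk.
set delta : R := (2 * c * #|V j|%:R) ^- 2 in mix.
have mixB : is_mixing (adj j) delta B.
  by apply: is_mixing_leq (TB j) (mix j).1.
have [tlow thigh] := andP (tE j).
have Er0 : 0 < #|edges (adj j)|%:R :> R by rewrite ltr0n.
have kr0 : 0 < (k j)%:R :> R by rewrite ltr0n.
have En : #|edges (adj j)|%:R <= #|V j|%:R ^+ 2 :> R.
  by rewrite -natrX ler_nat card_edges_le.
have nr1 : 1 <= #|V j|%:R :> R by rewrite ler1n ltnW.
have t_le : (t j)%:R <= thi * #|edges (adj j)|%:R.
  apply: le_trans thigh _; rewrite ler_pdivrMr // ler_peMr //.
  by rewrite mulr_ge0 // ltW.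
have kappa_ge : (2 * B + 1)%:R + (t j)%:R * (#|edges (adj j)|%:R^-1 + delta * 2) <= kappa.
  rewrite lerD2l mulrDr.
  have t1 : (t j)%:R / #|edges (adj j)|%:R <= thi by rewrite ler_pdivrMr.
  (* Here [|E| <= n ^ 2] and [2 <= (2 * c) ^ 2] are played against [delta = (2 * c * n) ^- 2]. *)
  have t2 : (t j)%:R * (delta * 2) <= thi.
    have d0 : 0 < (2 * c * #|V j|%:R) ^+ 2 by rewrite exprn_gt0 // !mulr_gt0 //; lra.
    rewrite mulrCA mulrC /delta ler_pdivrMr //.
    apply: (@le_trans _ _ (thi * #|V j|%:R ^+ 2 * 2)).
      by rewrite ler_wpM2r //; apply: le_trans t_le _; rewrite ler_wpM2l // ltW.
    rewrite -mulrA ler_wpM2l ?(ltW thi0) // [leRHS]exprMn mulrC.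
    by rewrite ler_wpM2r ?exprn_ge0 //; nra.
  lra.
have P1 : p0 <= P_geq (adj j) (t j) S 1.
  apply: le_trans (P_geq1_ge (simple j) deg0 edges0 mixB kappa0 kappa_ge SE Sk eta01 P2 PS).
  rewrite ler_wpM2r ?(ltW (divr_gt0 _ _)) // mulrA ler_pdivlMr // mulrC.
  by move: tlow; rewrite ler_pdivrMr // mulrC [in leRHS]mulrC.
have mL : 3 * L j <= p0 * tau * m%:R.
  have -> : 3 * L j = p0 * tau * (M * L j) by rewrite /M; field; rewrite !gt_eqF.
  by apply: ler_wpM2l (ltW mhi); rewrite ltW // mulr_gt0.
have kL : #|edges (adj j)|%:R ^+ k j <= expR (2 * L j).
  rewrite /L mulrCA expRM_natl -[2]/(2%:R) expRM_natl lnK ?posrE ?(lt_le_trans ltr01) //.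
  by rewrite lerXn2r ?nnegrE ?exprn_ge0.
have nvis_le f := expect_nvis_le (f := f) (simple j) deg0 edges0 Sk eta01 P2 PS.
rewrite !mul1r; split.
  (* Lower tail: the product of the weights is [expR] of minus the number of hits, so it is at least
     [expR (- L j)] when there are fewer than [L j] hits. *)
  apply: (@prob_walks_ge _ _ _ (simple j) deg0 edges0 (t j) m (k j) S
    (fun l => expR (- (0 < l)%N%:R)) (p0 * tau) (L j)) => // [l||W].
  - exact: expR_ge0.
  - apply: le_trans (nvis_le (fun l => expR (- (0 < l)%N%:R)) _) _ => [[]//|].
    rewrite oppr0 expR0 lerD2l.
    (* The weight is constant on positive arguments, so only [l = 0] contributes. *)
    have -> : \sum_(l < k j) (expR (- (0 < l.+1)%N%:R) - expR (- (0 < l)%N%:R))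
        * eta ^+ l = expR (-1) - 1 :> R.
      case: (k j) k1 => // k' _; rewrite big_ord_recl big1 => [|i _] /=.
        by rewrite oppr0 expR0 expr0 mulr1 addr0.
      by rewrite subrr mul0r.
    rewrite -[expR (-1) - 1]opprB mulrN lerN2 ler_pM ?(ltW p00) ?(ltW tau0) //.
    by rewrite /tau ge_min lexx orbT.
  - rewrite negb_and.
    (* The upper bound on hits holds surely, since there are only [m] walks; failure means too few
       hits. *)
    have -> : (num_hit S W)%:R <= A * B.+1%:R * (k j)%:R * ln #|V j|%:R.
      apply: (@le_trans _ _ m%:R).
        by rewrite ler_nat -[leqRHS](card_ord m) max_card.
      apply: le_trans mA _; rewrite -!mulrA ler_wpM2l ?(ltW A0) //.
      by rewrite ler_peMl ?(ltW L0) // ler1n.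
    rewrite orbF -ltNge -/(L j) => hit_lt.
    rewrite -expR_sum -expRD sumrN -num_hitE -[leLHS]expR0 ler_expR subr_ge0.
    exact: ltW.
apply: (@prob_walks_ge _ _ _ (simple j) deg0 edges0 (t j) m (k j) S
    (tilt eta eps al) (p0 * tau) (L j)) => // [l||W].
- exact: expR_ge0.
- apply: le_trans (nvis_le (tilt eta eps al) _) _ => [l|].
    by apply: tilt_incr; apply: ltW.
  have -> : tilt eta eps al 0 = 1 by rewrite /tilt mulr0 subr0 mulr0 expR0.
  rewrite lerD2l.
  apply: (@le_trans _ _ (P_geq (adj j) (t j) S 1 * (rho - 1))).
    by rewrite ler_wpM2l ?(le_trans (ltW p00)) // sum_tilt.
  rewrite -[rho - 1]opprB mulrN lerN2 ler_pM ?(ltW p00) ?(ltW tau0) //.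
  by rewrite /tau ge_min lexx.
(* More than [b] visits per hit makes the exponent of the tilted product nonnegative, and
   [expR (L j)] is at least one. *)
- rewrite -ltNge => vis_gt.
  rewrite -expR_sum -expRD -[leLHS]expR0 ler_expR addr_ge0 ?(ltW L0) //.
  rewrite -mulr_sumr mulr_ge0 ?(ltW al0) // sumrB -mulr_sumr -num_hitE -natr_sum.
  by rewrite subr_ge0 ltW // mulrAC.
Qed.
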